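(* Let $\mathcal{S}=\{A_1,\dots,A_k\}$ be a Sperner family in $\{1,\dots,n\}$ with $k\ge2$. If $|A_j|\ge2$ for each $j$ and $\bigcap_{j=1}^kA_j=\emptyset$, then the module $h_{\mathcal{S}}$ has a unique fixed point in $(0,1)$, and this fixed point is repellent.
   Context: A Sperner family in $\{1,\dots,n\}$ is a collection of nonempty subsets of $\{1,\dots,n\}$, none of which is contained in another. Its Sperner statistic is $H_{\mathcal{S}}(x_1,\dots,x_n)=\max_{1\le j\le k}\min_{i\in A_j}x_i$. The module $h_{\mathcal{S}}:[0,1]\to[0,1]$ is the function with $\mathbf{P}(H_{\mathcal{S}}(X_1,\dots,X_n)\le t)=h_{\mathcal{S}}(\mathbf{P}(X\le t))$ for every random variable $X$, independent copies $X_1,\dots,X_n$ of $X$, and $t\in\mathbb{R}$; explicitly it is the polynomial $h_{\mathcal{S}}(t)=\sum_{I\subseteq\{1,\dots,k\}}(-1)^{|I|}(1-t)^{|\bigcup_{i\in I}A_i|}$. A fixed point $p$ of $h_{\mathcal S}$ (a point with $h_{\mathcal S}(p)=p$) is called repellent if $h_{\mathcal{S}}'(p)\ge1$. *)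

(* Defs.v *)
From mathcomp Require Import all_boot all_order all_algebra.
From mathcomp Require Import all_classical all_reals all_analysis.
Set Implicit Arguments.
Unset Strict Implicit.
Unset Printing Implicit Defensive.
Import Order.TTheory GRing.Theory Num.Theory.
Import numFieldNormedType.Exports.
Local Open Scope ring_scope.

(* The ground set {1, ..., n} is represented by 'I_n = {0, ..., n-1}. *)
Definition sperner_family (n : nat) (S : {set {set 'I_n}}) : Prop :=
  (forall A, A \in S -> A != finset.set0) /\
  (forall A B, A \in S -> B \in S -> A \subset B -> A = B).

(* The Sperner statistic max_j min_(i in A_j) X_i is at most x iff no A_j has
   all its X_i above x. When P(X <= x) = t, inclusion-exclusion over the
   subfamilies I of S gives this polynomial in t as the probability of that
   event; [finset.cover I] is the union of the members of I. *)
Definition sperner_module (R : realType) (n : nat) (S : {set {set 'I_n}})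
    (t : R) : R :=
  \sum_(I in powerset S) (-1) ^+ #|I| * (1 - t) ^+ #|finset.cover I|.

Definition fixed_point (R : realType) (h : R -> R) (p : R) : Prop := h p = p.

Definition repellent (R : realType) (h : R -> R) (p : R) : Prop :=
  fixed_point h p /\ 1 <= h^`()%classic p.

(* Main.v *)
Require Import Defs.
From mathcomp Require Import all_boot all_order all_algebra.
From mathcomp Require Import all_classical all_reals all_analysis.
From mathcomp Require Import ring lra.
Import Order.TTheory GRing.Theory Num.Theory.
Import numFieldNormedType.Exports.
Local Open Scope ring_scope.

(** Pick every element of the ground set independently with probability [q] and
    let [F(q)] be the probability that the random set contains some member of
    the Sperner family [S].  Inclusion-exclusion over subfamilies gives
    [h(t) = 1 - F(1 - t)] ([sperner_moduleE]), so [p] is a fixed point of [h] iff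
    [1 - p] is one of [F], and the derivatives agree there.  Everything is
    therefore about the reliability polynomial [F] of a monotone system.

    The heart is the Moore-Shannon inequality [F (1 - F) <= q (1 - q) F'],
    proved by conditioning on one element [i]: if [a] and [c] are the conditional
    reliabilities with [i] present and absent, then [F = q a + (1 - q) c], and
    the defect [q (1 - q) F' - F (1 - F)] is the average of the two conditional
    defects plus [q (1 - q) (a - c) (1 - (a - c))] ([moore_shannon_step]).  The
    last term is positive as soon as [i] is pivotal for some set ([a > c]) and
    does not suffice alone ([a < 1]).  Any element [i] of any [A] in [S] is of
    this kind: [A] without [i] contains no member of [S] since [S] is an
    antichain, and no member has fewer than two elements.

    The strict inequality at a fixed point in (0,1) reads [F' > 1], whence
    repellence.  It also says that the odds ratio of [F(q)] to [q] is strictly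
    monotone on (0,1); fixed points are the places where this ratio is 1, whence
    uniqueness ([fixed_point_unique], by Rolle).

    For existence, [F'(0)] counts the singletons containing a member of [S] and
    [F'(1)] counts the elements belonging to all members, so both vanish.  Hence
    [F] lies below the diagonal near 0 and above it near 1
    ([fixed_point_exists]). *)

Set Implicit Arguments.
Unset Strict Implicit.
Unset Printing Implicit Defensive.

(** * Expectation over a random subset *)

(** The expectation of [w X], as a polynomial in [q], where [X] is the random
    subset of [s] containing each entry independently with probability [q].  The
    recursion conditions on the head of [s]; this is the shape in which the
    Moore-Shannon induction runs, and any element can be put at the head. *)
Fixpoint expect_poly (R : comNzRingType) (T : finType) (s : seq T)
    (w : {set T} -> R) : {poly R} :=
  if s is i :: s' then
    'X * expect_poly s' (fun X => w (i |: X)%SET)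
    + (1 - 'X) * expect_poly s' w
  else (w finset.set0)%:P.

Lemma subset_seq_cons (T : finType) (i : T) (s : seq T) (X : {set T}) :
  X \subset s -> (i |: X)%SET \subset i :: s.
Proof.
move=> /fintype.subsetP sX; apply/fintype.subsetP => j.
by rewrite !inE => /orP[->//|/sX ->]; rewrite orbT.
Qed.

Lemma subset_seq_consr (T : finType) (i : T) (s : seq T) (X : {set T}) :
  X \subset s -> X \subset i :: s.
Proof.
move=> sX; apply: fintype.subset_trans sX _.
by apply/fintype.subsetP => j; rewrite inE orbC => ->.
Qed.

Lemma set0_subset_seq (T : finType) (s : seq T) :
  (finset.set0 : {set T}) \subset s.
Proof. by apply/fintype.subsetP => j; rewrite inE. Qed.

Lemma subset_seq_nil (T : finType) (X : {set T}) :
  X \subset ([::] : seq T) -> X = finset.set0.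
Proof.
move=> /fintype.subsetP X0; apply/finset.setP => j; rewrite inE.
by apply/negP => /X0.
Qed.

Lemma subset_seq_setD1 (T : finType) (i : T) (s : seq T) (X : {set T}) :
  X \subset i :: s -> (X :\ i)%SET \subset s.
Proof.
move=> /fintype.subsetP sX; apply/fintype.subsetP => j.
by rewrite !inE => /andP[ji /sX]; rewrite inE (negPf ji).
Qed.

Lemma setD1_notin (T : finType) (i : T) (X : {set T}) :
  i \notin X -> (X :\ i)%SET = X.
Proof.
by move=> niX; apply/finset.setDidPl; rewrite disjoint_sym disjoints1.
Qed.

Lemma eq_expect (R : comNzRingType) (T : finType) (s : seq T)
    (v w : {set T} -> R) :
  (forall X : {set T}, X \subset s -> v X = w X) ->
  expect_poly s v = expect_poly s w.
Proof.
elim: s v w => [|i s ih] v w vw /=; first by rewrite vw // set0_subset_seq.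
congr (_ * _ + _ * _); apply: ih => X sX; apply: vw.
- exact: subset_seq_cons.
- exact: subset_seq_consr.
Qed.

Lemma expect_cst (R : comNzRingType) (T : finType) (s : seq T) (c : R) :
  expect_poly s (fun _ : {set T} => c) = c%:P.
Proof. by elim: s => //= i s ->; rewrite -mulrDl addrC subrK mul1r. Qed.

Lemma expectD (R : comNzRingType) (T : finType) (s : seq T)
    (v w : {set T} -> R) :
  expect_poly s (fun X => v X + w X) = expect_poly s v + expect_poly s w.
Proof.
by elim: s v w => [|i s ih] v w /=; rewrite ?polyCD // !ih !mulrDr addrACA.
Qed.

Lemma expectZ (R : comNzRingType) (T : finType) (s : seq T) (c : R)
    (w : {set T} -> R) :
  expect_poly s (fun X => c * w X) = c *: expect_poly s w.
Proof.
elim: s w => [|i s ih] w /=; first by rewrite polyCM mul_polyC.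
by rewrite !ih scalerDr !scalerAr.
Qed.

Lemma expect_sum (R : comNzRingType) (T : finType) (s : seq T) (J : Type)
    (r : seq J) (P : pred J) (w : J -> {set T} -> R) :
  expect_poly s (fun X => \sum_(j <- r | P j) w j X)
  = \sum_(j <- r | P j) expect_poly s (w j).
Proof.
elim: s w => [|i s ih] w /=; first by rewrite raddf_sum.
by rewrite !ih !mulr_sumr -big_split.
Qed.

(** A fixed [B] is entirely picked with probability [q ^ #|B|]. *)
Lemma expect_subset (R : comNzRingType) (T : finType) (s : seq T)
    (B : {set T}) :
  uniq s -> B \subset s ->
  expect_poly s (fun X => (B \subset X)%:R : R) = 'X^#|B|.
Proof.
elim: s B => [|i s ih] B /=.
  by move=> _ /subset_seq_nil ->; rewrite finset.sub0set cards0.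
case/andP=> nis us sB; have [iB|niB] := boolP (i \in B); last first.
  have sB' : B \subset s by rewrite -(setD1_notin niB) subset_seq_setD1.
  rewrite ih // (eq_expect (w := fun X => (B \subset X)%:R)) ?ih //.
    by rewrite -mulrDl addrC subrK mul1r.
  by move=> X sX; rewrite -finset.subDset setD1_notin.
rewrite [X in _ + _ * X](eq_expect (w := fun=> 0)); last first.
  move=> X /fintype.subsetP sX; case: fintype.subsetP => // /(_ i iB) /sX is_.
  by rewrite is_ in nis.
rewrite expect_cst mulr0 addr0.
rewrite (eq_expect (w := fun X => (B :\ i \subset X)%SET%:R)); last first.
  by move=> X _; rewrite finset.subDset.
by rewrite ih ?subset_seq_setD1 // (cardsD1 i B) iB exprS.
Qed.

Lemma horner_expect_cons (R : comNzRingType) (T : finType) (i : T) (s : seq T)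
    (w : {set T} -> R) (q : R) :
  (expect_poly (i :: s) w).[q]
  = q * (expect_poly s (fun X => w (i |: X)%SET)).[q]
    + (1 - q) * (expect_poly s w).[q].
Proof. by rewrite /= !hornerE. Qed.

Lemma horner_deriv_expect_cons (R : comNzRingType) (T : finType) (i : T)
    (s : seq T) (w : {set T} -> R) (q : R) :
  (expect_poly (i :: s) w)^`().[q]
  = (expect_poly s (fun X => w (i |: X)%SET)).[q] - (expect_poly s w).[q]
    + q * (expect_poly s (fun X => w (i |: X)%SET))^`().[q]
    + (1 - q) * (expect_poly s w)^`().[q].
Proof. by rewrite /= !poly.derivE !hornerE /=; ring. Qed.

(** * Monotonicity *)

Lemma le_expect (R : realFieldType) (T : finType) (s : seq T)
    (v w : {set T} -> R) (q : R) :
  0 <= q <= 1 -> (forall X, v X <= w X) ->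
  (expect_poly s v).[q] <= (expect_poly s w).[q].
Proof.
move=> /andP[q0 q1]; elim: s v w => [|i s ih] v w vw.
  by rewrite /= !hornerE.
rewrite !horner_expect_cons.
 by apply: lerD; apply: ler_wpM2l; rewrite ?subr_ge0 //; apply: ih.
Qed.

(** For [0 < q < 1] every subset of [s] has positive probability, so a single
    strict inequality is seen by the expectation. *)
Lemma lt_expect (R : realFieldType) (T : finType) (s : seq T)
    (v w : {set T} -> R) (q : R) (X : {set T}) :
  0 < q < 1 -> (forall Y, v Y <= w Y) -> X \subset s -> v X < w X ->
  (expect_poly s v).[q] < (expect_poly s w).[q].
Proof.
move=> /andP[q0 q1]; have q01 : 0 <= q <= 1 by rewrite !ltW.
elim: s v w X => [|i s ih] v w X vw sX vwX.
  by rewrite /= !hornerE -(subset_seq_nil sX).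
rewrite !horner_expect_cons.
have sXi := subset_seq_setD1 sX.
have [iX|niX] := boolP (i \in X).
  apply: ltr_leD; last first.
    by apply: ler_wpM2l; [rewrite subr_ge0 ltW|apply: le_expect].
  rewrite ltr_pM2l //; apply: (ih _ _ (X :\ i)%SET) => //.
  by rewrite finset.setD1K.
apply: ler_ltD; first by apply: ler_wpM2l; [rewrite ltW|apply: le_expect].
rewrite ltr_pM2l ?subr_gt0 //; apply: (ih _ _ X) => //.
by rewrite -(setD1_notin niX).
Qed.

(** * The Moore-Shannon inequality *)

Definition up_closed (T : finType) (b : pred {set T}) : Prop :=
  forall X Y : {set T}, X \subset Y -> b X -> b Y.

Definition rel_poly (R : comNzRingType) (T : finType) (s : seq T)
    (b : pred {set T}) : {poly R} :=
  expect_poly s (fun X => (b X)%:R).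

Lemma up_closed_add (T : finType) (b : pred {set T}) (i : T) :
  up_closed b -> up_closed (fun X => b (i |: X)%SET).
Proof. by move=> bup X Y XY; apply: bup; apply: finset.setUS. Qed.

Lemma rel_poly_add_ge (R : realFieldType) (T : finType) (s : seq T)
    (b : pred {set T}) (i : T) (q : R) :
  up_closed b -> 0 <= q <= 1 ->
  (rel_poly R s b).[q] <= (rel_poly R s (fun X => b (i |: X)%SET)).[q].
Proof.
move=> bup q01; apply: le_expect => // X; rewrite ler_nat.
by case bX: (b X) => //; rewrite (bup X) // finset.subsetUr.
Qed.

Lemma rel_poly_ge0 (R : realFieldType) (T : finType) (s : seq T)
    (b : pred {set T}) (q : R) : 0 <= q <= 1 -> 0 <= (rel_poly R s b).[q].
Proof.
move=> q01; rewrite -[X in X <= _](hornerC 0 q) -(expect_cst s).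
by apply: le_expect => // X; rewrite ler0n.
Qed.

Lemma rel_poly_le1 (R : realFieldType) (T : finType) (s : seq T)
    (b : pred {set T}) (q : R) : 0 <= q <= 1 -> (rel_poly R s b).[q] <= 1.
Proof.
move=> q01; rewrite -[X in _ <= X](hornerC 1 q) -(expect_cst s).
by apply: le_expect => // X; rewrite lern1; case: (b X).
Qed.

(** Here [a], [c] are the reliabilities conditioned on the presence and on the
    absence of an element, [a'], [c'] their derivatives.  Besides the product
    rule for [F'], the identity is the decomposition of a variance into the mean
    conditional variance, which is [q a (1 - a) + (1 - q) c (1 - c)], and the
    variance of the conditional mean, which is [q (1 - q) (a - c) ^ 2]. *)
Lemma moore_shannon_step (R : comPzRingType) (q a c a' c' : R) :
  let f := q * a + (1 - q) * c in
  q * (1 - q) * (a - c + q * a' + (1 - q) * c') - f * (1 - f)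
  = q * (q * (1 - q) * a' - a * (1 - a))
    + (1 - q) * (q * (1 - q) * c' - c * (1 - c))
    + q * (1 - q) * ((a - c) * (1 - (a - c))).
Proof. by move=> f; rewrite /f; ring. Qed.

(** By induction on [s]: all three terms of [moore_shannon_step] are nonnegative
    because [0 <= a - c <= 1].  The base case is where it matters that [b] takes
    only the values 0 and 1. *)
Lemma moore_shannon (R : realFieldType) (T : finType) (s : seq T)
    (b : pred {set T}) (q : R) :
  up_closed b -> 0 <= q <= 1 ->
  (rel_poly R s b).[q] * (1 - (rel_poly R s b).[q])
    <= q * (1 - q) * (rel_poly R s b)^`().[q].
Proof.
move=> bup q01; have /andP[q0 q1] := q01.
elim: s b bup => [|i s ih] b bup.
  by rewrite /rel_poly /= derivC !hornerE; case: (b _);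
     rewrite ?subrr ?mulr0 ?mul0r.
rewrite -subr_ge0 /rel_poly horner_expect_cons horner_deriv_expect_cons.
rewrite moore_shannon_step.
have lca := rel_poly_add_ge s i bup q01.
have a1 := rel_poly_le1 s (fun X => b (i |: X)%SET) q01.
have c0 := rel_poly_ge0 s b q01.
have q1' : 0 <= 1 - q by rewrite subr_ge0.
rewrite !addr_ge0 ?mulr_ge0 ?subr_ge0 ?ih //; first exact: up_closed_add.
by rewrite lerBlDr (le_trans a1) // lerDl.
Qed.

(** Pivotality of [i] at [X] gives [c < a], and the failure of the singleton of
    [i] gives [a < 1]; then the last term of [moore_shannon_step] is positive. *)
Lemma moore_shannon_strict (R : realFieldType) (T : finType) (i : T)
    (s : seq T) (b : pred {set T}) (q : R) (X : {set T}) :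
  up_closed b -> 0 < q < 1 -> X \subset s -> ~~ b X -> b (i |: X)%SET ->
  ~~ b [set i]%SET ->
  (rel_poly R (i :: s) b).[q] * (1 - (rel_poly R (i :: s) b).[q])
    < q * (1 - q) * (rel_poly R (i :: s) b)^`().[q].
Proof.
move=> bup q01 sX nbX biX nbi; have /andP[q0 q1] := q01.
have q01' : 0 <= q <= 1 by rewrite !ltW.
rewrite -subr_gt0 /rel_poly horner_expect_cons horner_deriv_expect_cons.
rewrite moore_shannon_step.
have q1' : 0 < 1 - q by rewrite subr_gt0.
have lca : (rel_poly R s b).[q] < (rel_poly R s (fun X => b (i |: X)%SET)).[q].
  apply: (lt_expect (X := X)) => //; last by rewrite (negPf nbX) biX ltr01.
  move=> Y; rewrite ler_nat.
  by case bY: (b Y) => //; rewrite (bup Y) // finset.subsetUr.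
have a1 : (rel_poly R s (fun X => b (i |: X)%SET)).[q] < 1.
  rewrite -[X in _ < X](hornerC 1 q) -(expect_cst s).
  apply: (lt_expect (X := finset.set0)) => //; last first.
  - by rewrite finset.setU0 (negPf nbi) ltr01.
  - exact: set0_subset_seq.
  - by move=> Y; rewrite lern1; case: (b _).
have c0 := rel_poly_ge0 s b q01'.
apply: ltr_wpDl; last first.
  rewrite !mulr_gt0 ?subr_gt0 //.
  by rewrite ltrBlDr (lt_le_trans a1) // lerDl.
rewrite addr_ge0 // mulr_ge0 ?(ltW q0) ?(ltW q1') // subr_ge0 moore_shannon //.
exact: up_closed_add.
Qed.

(** * Values and slopes at the end points *)

Lemma expect_at0 (R : comNzRingType) (T : finType) (s : seq T)
    (w : {set T} -> R) : (expect_poly s w).[0] = w finset.set0.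
Proof.
elim: s w => [|i s ih] w; first by rewrite /= hornerC.
by rewrite horner_expect_cons !ih mul0r add0r subr0 mul1r.
Qed.

Lemma expect_at1 (R : comNzRingType) (T : finType) (s : seq T)
    (w : {set T} -> R) : (expect_poly s w).[1] = w [set:: s]%SET.
Proof.
elim: s w => [|i s ih] w; first by rewrite /= hornerC finset.set_nil.
by rewrite horner_expect_cons !ih subrr mul0r addr0 mul1r finset.set_cons.
Qed.

(** Near [q = 0] at first order at most one element is picked, and near [q = 1],
    in [deriv_expect_at1], at most one is missing. *)
Lemma deriv_expect_at0 (R : comNzRingType) (T : finType) (s : seq T)
    (w : {set T} -> R) :
  (expect_poly s w)^`().[0] = \sum_(i <- s) (w [set i]%SET - w finset.set0).
Proof.
elim: s w => [|i s ih] w; first by rewrite /= derivC hornerC big_nil.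
rewrite horner_deriv_expect_cons big_cons !ih !expect_at0 finset.setU0; ring.
Qed.

Lemma deriv_expect_at1 (R : comNzRingType) (T : finType) (s : seq T)
    (w : {set T} -> R) : uniq s ->
  (expect_poly s w)^`().[1]
  = \sum_(i <- s) (w [set:: s]%SET - w ([set:: s] :\ i)%SET).
Proof.
elim: s w => [|i s ih] w /=; first by rewrite derivC hornerC big_nil.
case/andP=> nis us; rewrite -[X in X^`()]/(expect_poly (i :: s) w).
rewrite horner_deriv_expect_cons big_cons !ih // !expect_at1 subrr mul0r addr0.
rewrite mul1r finset.set_cons finset.setU1K ?inE //; congr (_ + _).
apply: eq_big_seq => j js; congr (_ - w _).
apply/finset.setP => k; rewrite !inE; have [->|//] := eqVneq k i.
by rewrite /= (contraNneq _ nis) // => ->.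
Qed.

(** * The Sperner module as a reliability polynomial *)

(** Expansion of a product of factors [1 - 1], one for each element of [B]. *)
Lemma sum_powerset_sign (R : comNzRingType) (T : finType) (B : {set T}) :
  \sum_(I in powerset B) (-1) ^+ #|I| = (B == finset.set0)%:R :> R.
Proof.
transitivity (\prod_(A : T) ((if A \in B then -1 else 0) + 1) : R).
  (* Outside B the factor is 0 + 1, so only the choices I inside B survive. *)
  rewrite bigA_distr big_mkcond; apply: eq_bigr => I _; rewrite powersetE.
  rewrite -big_mkcond.
  have [sIB|] := boolP (I \subset B).
    rewrite (eq_bigr (fun=> -1)) ?prodr_const // => A AI.
    by rewrite (fintype.subsetP sIB).
  case/subsetPn => A AI nAB.
  by rewrite (bigD1 A) //= (negPf nAB) mul0r.
have [->|/finset.set0Pn[A AB]] := eqVneq B finset.set0.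
  by rewrite big1 // => A _; rewrite inE add0r.
by rewrite (bigD1 A) //= AB addNr mul0r.
Qed.

Definition works (T : finType) (S : {set {set T}}) (X : {set T}) : bool :=
  [exists A in S, A \subset X].

Lemma worksP (T : finType) (S : {set {set T}}) (X : {set T}) :
  reflect (exists2 A : {set T}, A \in S & A \subset X) (works S X).
Proof. exact: exists_inP. Qed.

Lemma works_up_closed (T : finType) (S : {set {set T}}) :
  up_closed (works S).
Proof.
move=> X Y XY /worksP[A AS AX]; apply/worksP; exists A => //.
exact: fintype.subset_trans AX XY.
Qed.

(** The union of [I] lies in [X] iff [I] consists of members of [S] that lie in
    [X], so the left side is the alternating sum over all families of such
    members; it is 1 if there is none and 0 otherwise. *)
Lemma works_incl_excl (R : comNzRingType) (T : finType) (S : {set {set T}})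
    (X : {set T}) :
  \sum_(I in powerset S) (-1) ^+ #|I| * (finset.cover I \subset X)%:R
  = 1 - (works S X)%:R :> R.
Proof.
transitivity (([set A in S | A \subset X]%SET == finset.set0)%:R : R).
  rewrite -sum_powerset_sign big_mkcond [RHS]big_mkcond; apply: eq_bigr => I _.
  rewrite !powersetE.
  have -> : (I \subset [set A in S | A \subset X]%SET)
     = (I \subset S) && (finset.cover I \subset X).
    apply/fintype.subsetP/andP 
      => [sI|[/fintype.subsetP sI /finset.bigcupsP sX] A AI].
      split; first by apply/fintype.subsetP => A /sI; rewrite inE => /andP[].
      by apply/finset.bigcupsP => A /sI; rewrite inE => /andP[].
    by rewrite inE sI ?sX.
  by case: (I \subset S); case: (_ \subset X); rewrite /= ?mulr1 ?mulr0.
case: worksP => [[A AS AX]|no].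
  rewrite subrr; case: eqP => // /finset.setP /(_ A).
  by rewrite !inE AS AX.
rewrite subr0; case: eqP => //; case; apply/finset.setP => A; rewrite !inE.
by apply/negP => /andP[AS AX]; apply: no; exists A.
Qed.

(** The expectation of [works_incl_excl], by linearity and [expect_subset].  The
    enumeration [s] is arbitrary, which leaves its head to be chosen freely. *)
Lemma sperner_moduleE (R : realType) (n : nat) (S : {set {set 'I_n}})
    (s : seq 'I_n) (t : R) :
  uniq s -> (forall i, i \in s) ->
  sperner_module S t = 1 - (rel_poly R s (works S)).[1 - t].
Proof.
move=> us sT.
have -> : rel_poly R s (works S)
    = 1 - \sum_(I in powerset S) (-1) ^+ #|I| *: 'X^#|finset.cover I|.
  apply: (canRL (subKr _)).
  rewrite -[LHS]/(1%:P - _) -(expect_cst s) /rel_poly -scaleN1r -expectZ.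
  rewrite -expectD.
  transitivity (expect_poly s (fun X => \sum_(I in powerset S)
       (-1) ^+ #|I| * (finset.cover I \subset X)%:R : R)).
    by apply: eq_expect => X _; rewrite works_incl_excl mulN1r.
  rewrite expect_sum; apply: eq_bigr => I _.
  rewrite expectZ expect_subset //.
  by apply/fintype.subsetP => j _; rewrite sT.
rewrite !hornerE subKr horner_sum /sperner_module; apply: eq_bigr => I _.
by rewrite !hornerE.
Qed.

(** * Fixed points *)

(** Both end points are roots, so [F - 'X = 'X * ('X - 1) * Q], and the slopes
    force [Q] to be 1 at 0 and -1 at 1; a root of [Q] in between is interior. *)
Lemma fixed_point_exists (R : rcfType) (F : {poly R}) :
  F.[0] = 0 -> F.[1] = 1 -> F^`().[0] = 0 -> F^`().[1] = 0 ->
  exists2 p, 0 < p < 1 & F.[p] = p.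
Proof.
move=> F0 F1 dF0 dF1.
have /factor_theorem[P PE] : root (F - 'X) 0 by rewrite /root !hornerE F0 subr0.
have P1 : root P 1.
  have := congr1 (fun r : {poly R} => r.[1]) PE.
  by rewrite /root !hornerE F1 subrr subr0 mulr1 => <-.
have /factor_theorem[Q QE] := P1.
have dE := congr1 (fun p : {poly R} => p^`()) PE.
have := congr1 (fun r : {poly R} => r.[0]) dE.
have := congr1 (fun r : {poly R} => r.[1]) dE.
rewrite QE !poly.derivE !hornerE /= dF0 dF1 => Q1 Q0.
have [||p p01] := @poly_ivt R (- Q) 0 1; first exact: ler01.
  by rewrite !hornerN; apply/andP; split; lra.
rewrite rootN => /rootP Qp; exists p; last first.
  have := congr1 (fun r : {poly R} => r.[p]) PE; rewrite QE !hornerE Qp; lra.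
rewrite !lt_neqAle andbACA p01 andbT; apply/andP; split; apply/eqP => e.
  by move: Qp Q0; rewrite -e => ->; lra.
by move: Qp Q1; rewrite e => ->; lra.
Qed.

(** Rolle's theorem for [N / D], with the denominators cleared. *)
Lemma poly_quotient_rolle (R : realType) (N D : {poly R}) (p q : R) :
  p < q -> (forall x, p <= x <= q -> 0 < D.[x]) ->
  N.[p] / D.[p] = N.[q] / D.[q] ->
  exists2 c, p < c < q & N^`().[c] * D.[c] = N.[c] * D^`().[c].
Proof.
move=> pq D0 eqpq; pose g x := N.[x] / D.[x].
have Dn x : p <= x <= q -> D.[x] != 0 by move=> /D0; apply: lt0r_neq0.
pose dg x := N.[x] * (- D.[x] ^- 2 * D^`().[x]) + D.[x]^-1 * N^`().[x].
have der x : p <= x <= q -> is_derive x (1 : R) g (dg x).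
  move=> xI; have dD := is_deriveV (Dn x xI) (is_derive_poly D x).
  exact: is_deriveM (is_derive_poly N x) dD.
have dable x : x \in `]p, q[%R -> derivable g x 1.
  by rewrite in_itv => /andP[px xq]; have [] := der x _; rewrite ?ltW.
have cont : {within `[p, q]%classic, continuous g}%classic.
  apply: derivable_within_continuous => x; rewrite in_itv => xI.
  by have [] := der x xI.
have [c] := Rolle pq dable cont eqpq.
rewrite in_itv /= => /andP[pc cq] dc0; exists c; first by rewrite pc.
have cI : p <= c <= q by rewrite !ltW.
have := @derive_val _ _ _ _ _ _ _ (der c cI).
rewrite (@derive_val _ _ _ _ _ _ _ dc0) /dg => /esym e.
have Dc := Dn c cI; apply/eqP; rewrite -subr_eq0; apply/eqP.
transitivity (D.[c] ^+ 2 * 0); last by rewrite mulr0.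
by rewrite -e; field.
Qed.

(** The odds ratio [F (1 - q) / (q (1 - F))] is 1 exactly at the fixed points.
    Between two of them its derivative would vanish, and the numerator of that
    derivative is [q (1 - q) F' - F (1 - F)]. *)
Lemma fixed_point_unique (R : realType) (F : {poly R}) :
  (forall q, 0 < q < 1 -> 0 < F.[q] < 1) ->
  (forall q, 0 < q < 1 -> F.[q] * (1 - F.[q]) < q * (1 - q) * F^`().[q]) ->
  forall p q, 0 < p < 1 -> 0 < q < 1 -> F.[p] = p -> F.[q] = q -> p = q.
Proof.
move=> F01 dF.
suff main p q :
    0 < p < 1 -> 0 < q < 1 -> F.[p] = p -> F.[q] = q -> p < q -> False.
  move=> p q p01 q01 Fp Fq; have [pq|qp|//] := ltgtP p q.
    by case: (main p q).
  by case: (main q p).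
move=> /andP[p0 p1] /andP[q0 q1] Fp Fq pq.
have odds x : 0 < x -> x < 1 -> F.[x] = x ->
    (F * (1 - 'X)).[x] / ('X * (1 - F)).[x] = 1.
  move=> x0 x1 Fx; rewrite !hornerE Fx divff //.
  by rewrite lt0r_neq0 // mulr_gt0 // subr_gt0.
have [||c /andP[pc cq]] :=
  @poly_quotient_rolle R (F * (1 - 'X)) ('X * (1 - F)) p q pq.
- move=> x /andP[px xq]; have x01 : 0 < x < 1 by apply/andP; split; lra.
  by rewrite !hornerE; have := F01 x x01; move: x01; nra.
- by rewrite !odds.
have c01 : 0 < c < 1 by apply/andP; split; lra.
rewrite !poly.derivE !hornerE /=; have := dF c c01; lra.
Qed.

Theorem theorem6p1 (R : realType) (n : nat) (S : {set {set 'I_n}})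
    (hS : sperner_family S) (hk : (2 <= #|S|)%N)
    (hcard : forall A : {set 'I_n}, A \in S -> (2 <= #|A|)%N)
    (hcap : (\bigcap_(A in S) A)%SET = finset.set0) :
  (exists! p : R, 0 < p < 1 /\ fixed_point (sperner_module S) p) /\
  (forall p : R, 0 < p < 1 -> fixed_point (sperner_module S) p ->
     repellent (sperner_module S) p).
Proof.
have [A AS] : exists A, A \in S by apply/card_gt0P; apply: leq_trans hk.
have [i iA] : exists i, i \in A.
  by apply/card_gt0P; apply: leq_trans (hcard _ AS).
(* The strict inequality needs the pivotal element i at the head. *)
pose s := i :: enum [set~ i]%SET.
have us : uniq s by rewrite /= mem_enum !inE eqxx enum_uniq.
have sT j : j \in s by rewrite inE mem_enum !inE orbN.
have sE : [set:: s]%SET = finset.setT.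
  by apply/finset.setP => j; rewrite inE sT inE.
pose b := works S; pose F := rel_poly R s b.
have bup : up_closed b by exact: works_up_closed.
have hE t : sperner_module S t = 1 - F.[1 - t] by exact: sperner_moduleE.
have fixE p : fixed_point (sperner_module S) p <-> F.[1 - p] = 1 - p.
  by rewrite /fixed_point hE; split; lra.
have flip (p : R) : 0 < p < 1 -> 0 < 1 - p < 1.
  by move=> ?; apply/andP; split; lra.
have small (X : {set 'I_n}) : (#|X| <= 1)%N -> b X = false.
  move=> X1; apply/negbTE/negP => /worksP[B BS BX].
  by have := leq_trans (hcard _ BS) (leq_trans (subset_leq_card BX) X1).
have b0 : b finset.set0 = false by apply: small; rewrite cards0.
have bT : b finset.setT by apply/worksP; exists A; rewrite ?finset.subsetT.
(* As no element lies in all members, some member survives the loss of j. *)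
have bC j : b (finset.setT :\ j)%SET.
  have : j \notin (\bigcap_(B in S) B)%SET by rewrite hcap inE.
  apply: contraR => nb; apply/finset.bigcapP => B BS; apply: contraR nb => jB.
  apply/worksP; exists B => //.
  by rewrite -(setD1_notin jB) finset.setSD // finset.subsetT.
have strict q : 0 < q < 1 -> F.[q] * (1 - F.[q]) < q * (1 - q) * F^`().[q].
  move=> q01; apply: (moore_shannon_strict (X := (A :\ i)%SET)) => //.
  - by apply/fintype.subsetP => j; rewrite !inE mem_enum !inE => /andP[].
  - apply/negP => /worksP[B BS BA].
    have BeA : B = A.
      by apply: (hS.2 _ _ BS AS); apply: fintype.subset_trans BA _;
         apply: finset.subsetDl.
    by move/fintype.subsetP/(_ i): BA; rewrite BeA iA !inE eqxx => /(_ isT).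
  - by rewrite finset.setD1K //; apply/worksP; exists A.
  - by rewrite small // cards1.
have F01 q : 0 < q < 1 -> 0 < F.[q] < 1.
  move=> q01; apply/andP; split.
    rewrite -[X in X < _](hornerC 0 q) -(expect_cst s).
    apply: (lt_expect (X := finset.setT)); rewrite ?bT ?ltr01 //.
    exact/fintype.subsetP.
  rewrite -[X in _ < X](hornerC 1 q) -(expect_cst s).
  apply: (lt_expect (X := finset.set0)); rewrite ?b0 ?ltr01 //.
  - by move=> Y; rewrite lern1; case: (b _).
  - exact: set0_subset_seq.
split.
  have [||||p p01 Fp] := @fixed_point_exists R F.
  - by rewrite /F /rel_poly expect_at0 b0.
  - by rewrite /F /rel_poly expect_at1 sE bT.
  - rewrite /F /rel_poly deriv_expect_at0 big1 // => j _.
    by rewrite b0 small ?cards1 // subrr.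
  - rewrite /F /rel_poly deriv_expect_at1 // big1 // => j _.
    by rewrite sE bT bC subrr.
  exists (1 - p); split.
    by split; [exact: flip|apply/fixE; rewrite subKr].
  move=> q [q01 /fixE Fq].
  have := @fixed_point_unique R F F01 strict p (1 - q) p01 (flip _ q01) Fp Fq.
  lra.
move=> p p01 fp; split=> //; move/fixE: fp => Fp.
have -> : sperner_module S = horner (1 - (F \Po (1 - 'X))).
  by apply/funext => t; rewrite hE !hornerE horner_comp !hornerE.
rewrite -derivE.
have -> : ((1 - (F \Po (1 - 'X)))^`() = F^`() \Po (1 - 'X))%R.
  by rewrite derivB deriv_comp derivB derivX derivC !sub0r mulrN mulr1 opprK.
rewrite horner_comp !hornerE.
have q01 := flip _ p01; have := strict _ q01; rewrite Fp.
rewrite -[X in X < _]mulr1 ltr_pM2l => [/ltW //|].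
by case/andP: q01 => q0 q1; rewrite mulr_gt0 // subr_gt0.
Qed.
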